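(* Let $n\ge p$. The map defined for $\mathcal X\in\mathrm{St}(n,p,l)$ and $\mathcal V\in T_{\mathcal X}\mathrm{St}(n,p,l)$ by $$R_{\mathcal X}(\mathcal V)=(\mathcal X+\mathcal V)*(\mathcal I+\mathcal V^\top*\mathcal V)^{-1/2}$$ is a (well-defined) retraction on $\mathrm{St}(n,p,l)$.
   Context: Frontal slices $A^{(i)}=\mathcal A(:,:,i)$. The t-product is $\mathcal A*\mathcal B=\operatorname{fold}(\operatorname{bcirc}(\mathcal A)\operatorname{unfold}(\mathcal B))$, where $\operatorname{bcirc}(\mathcal A)$ is the block circulant matrix with $(i,j)$ block $A^{(((i-j)\bmod l)+1)}$, $\operatorname{unfold}$ stacks frontal slices vertically, $\operatorname{fold}$ is its inverse. Transpose: $\mathcal A^\top$ has frontal slices $(A^{(1)})^\top,(A^{(l)})^\top,\dots,(A^{(2)})^\top$. $\mathcal I$ is the identity tensor; $\mathcal A^{-1}$ denotes the t-product inverse ($\mathcal A*\mathcal A^{-1}=\mathcal A^{-1}*\mathcal A=\mathcal I$). $\mathrm{St}(n,p,l)=\{\mathcal X\in\mathbb R^{n\times p\times l}:\mathcal X^\top*\mathcal X=\mathcal I\}$, an embedded submanifold of $\mathbb R^{n\times p\times l}$. A tensor $\mathcal A\in\mathbb R^{p\times p\times l}$ with $\mathcal A=\mathcal A^\top$ is symmetric t-positive (semi)definite if $\langle\mathcal Z,\mathcal A*\mathcal Z\rangle>0$ ($\ge0$) for all nonzero $\mathcal Z\in\mathbb R^{p\times 1\times l}$; for such a t-positive semidefinite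 $\mathcal A$, $\mathcal A^{1/2}$ is the unique symmetric t-positive semidefinite tensor $\mathcal S$ with $\mathcal S*\mathcal S=\mathcal A$, and for t-positive definite $\mathcal A$, $\mathcal A^{-1/2}=(\mathcal A^{1/2})^{-1}$. A retraction on a manifold $M$ is a smooth map $R:TM\to M$ such that $R_x(0_x)=x$ and $\mathrm DR_x(0_x)=\mathrm{id}_{T_xM}$ for all $x$. *)

(* Defs.v *)
From HB Require Import structures.
From mathcomp Require Import all_boot all_order all_algebra.
From mathcomp Require Import all_classical all_reals all_analysis.
Set Implicit Arguments. Unset Strict Implicit. Unset Printing Implicit Defensive.
Import Order.TTheory GRing.Theory Num.Theory.
Import numFieldNormedType.Exports.
Local Open Scope classical_set_scope.
Local Open Scope ring_scope.

(* A third-order tensor A in R^{n x p x l} is stored as an n x (l*p) matrix: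
   entry A(i,j,k) (frontal slice k, 0-based) is A i (mxvec_index k j).
   Matrices carry MathComp-Analysis' normed-module structure, so this is
   R^{n p l} with its usual topology; matrix addition/scaling are the
   entrywise tensor operations. *)
Definition tensor (R : realType) (n p l : nat) := 'M[R]_(n, l * p).

Section Tensors.
Variable R : realType.

Definition idx (a b : nat) (r : 'I_(a * b)) : 'I_a * 'I_b :=
  enum_val (cast_ord (esym (mxvec_cast a b)) r).

Definition slice n p l (A : tensor R n p l) (k : 'I_l) : 'M[R]_(n, p) :=
  \matrix_(i, j) A i (mxvec_index k j).

Definition tens_of n p l (S : 'I_l -> 'M[R]_(n, p)) : tensor R n p l :=
  \matrix_(i, c) S (idx c).1 i (idx c).2.

Definition tunfold n p l (A : tensor R n p l) : 'M[R]_(l * n, p) :=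
  \matrix_(r, j) slice A (idx r).1 (idx r).2 j.

Definition tfold n p l (M : 'M[R]_(l * n, p)) : tensor R n p l :=
  tens_of (fun k => \matrix_(i, j) M (mxvec_index k i) j).

Definition subord l (i j : 'I_l) : 'I_l :=
  Ordinal (ltn_pmod (i + l - j) (leq_ltn_trans (leq0n i) (ltn_ord i))).

Definition negord l (k : 'I_l) : 'I_l :=
  Ordinal (ltn_pmod (l - k) (leq_ltn_trans (leq0n k) (ltn_ord k))).

Definition bcirc n p l (A : tensor R n p l) : 'M[R]_(l * n, l * p) :=
  \matrix_(r, c) slice A (subord (idx r).1 (idx c).1) (idx r).2 (idx c).2.

Definition tmul n m p l (A : tensor R n m l) (B : tensor R m p l) : tensor R n p l :=
  tfold (bcirc A *m tunfold B).

Definition ttr n p l (A : tensor R n p l) : tensor R p n l :=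
  tens_of (fun k => (slice A (negord k))^T).

Definition tid p l : tensor R p p l :=
  tens_of (fun k => if val k == 0%N then 1%:M else 0).

Definition tinner n p l (A B : tensor R n p l) : R :=
  \sum_(i < n) \sum_(c < l * p) A i c * B i c.

Definition tsym p l (A : tensor R p p l) : Prop := ttr A = A.

Definition tpsd p l (A : tensor R p p l) : Prop :=
  tsym A /\ forall Z : tensor R p 1 l, 0 <= tinner Z (tmul A Z).

Definition tpd p l (A : tensor R p p l) : Prop :=
  tsym A /\ forall Z : tensor R p 1 l, Z != 0 -> 0 < tinner Z (tmul A Z).

(* A^{1/2}: the (unique, for t-psd A) symmetric t-psd S with S*S = A *)
Definition tsqrt p l (A : tensor R p p l) : tensor R p p l :=
  xget 0 [set S | tpsd S /\ tmul S S = A].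

Definition tinv p l (A : tensor R p p l) : tensor R p p l :=
  xget 0 [set B | tmul A B = tid p l /\ tmul B A = tid p l].

Definition tinvsqrt p l (A : tensor R p p l) : tensor R p p l :=
  tinv (tsqrt A).

Definition Stiefel n p l : set (tensor R n p l) :=
  [set X | tmul (ttr X) X = tid p l].

End Tensors.

(* C^k / C^oo maps between real normed spaces: all iterated directional
   derivatives exist and are continuous (equivalent to the usual C^k in
   finite dimension). *)
Fixpoint Ck (R : realType) (U W : normedModType R) (k : nat) (f : U -> W) : Prop :=
  match k with
  | 0%N => continuous f
  | k'.+1 => (forall x v, derivable f x v) /\ forall v, Ck k' (fun x => 'D_v f x)
  end.

Definition smooth (R : realType) (U W : normedModType R) (f : U -> W) : Prop :=
  forall k, Ck k f.

Definition tangentSt (R : realType) n p l (X : tensor R n p l) : set (tensor R n p l) :=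
  [set V | exists g : R -> tensor R n p l,
      smooth g /\ g 0 = X /\ (\forall t \near (0 : R), @Stiefel R n p l (g t)) /\
      'D_1 g 0 = V].

Definition retrSt (R : realType) n p l (X V : tensor R n p l) : tensor R n p l :=
  tmul (X + V) (tinvsqrt (tid R p l + tmul (ttr V) V)).

(* Main.v *)
Require Import Defs.
From HB Require Import structures.
From mathcomp Require Import all_boot all_order all_algebra.
From mathcomp Require Import complex lra.
From mathcomp Require Import all_classical all_reals all_analysis.
Set Implicit Arguments. Unset Strict Implicit. Unset Printing Implicit Defensive.
Import Order.TTheory GRing.Theory Num.Theory.
Import numFieldNormedType.Exports.
Local Open Scope classical_set_scope.
Local Open Scope ring_scope.

(* The block circulant map is an injective algebra morphism turning the tensor
   transpose into the matrix transpose, so everything reduces to matrices.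
   The square root S of A = I + V^T V is a polynomial in A (interpolate on the
   spectrum), hence again block circulant, and S >= I.  For M >= 0 and S >= I
   the Sylvester operator X |-> M X + X S is bounded below, which gives in turn
   uniqueness of S, its continuity, and its differentiability: since
   S(y) (S(y) - S(x)) + (S(y) - S(x)) S(x) = A(y) - A(x), the derivative of S is
   obtained by inverting the operator at (S(x), S(x)).  This expresses DS
   rationally in S and linearly in DA, so smoothness follows by induction on
   the order.  The image lies in the Stiefel manifold because tangency gives
   X^T V + V^T X = 0, i.e. (X + V)^T (X + V) = I + V^T V. *)

(** * Square roots of symmetric matrices *)

Section MatrixRoot.
Variable R : rcfType.

(** The order relation S >= c I, read on the quadratic form; symmetry is recorded separately. *)
Definition mx_ge n (c : R) (S : 'M[R]_n) : Prop :=
  forall z : 'cV[R]_n, c * (z^T *m z) 0 0 <= (z^T *m S *m z) 0 0.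

Lemma dotcv_ge0 n (z : 'cV[R]_n) : 0 <= (z^T *m z) 0 0.
Proof. by rewrite mxE sumr_ge0 // => i _; rewrite mxE -expr2 sqr_ge0. Qed.

Lemma dotcv_gt0 n (z : 'cV[R]_n) : z != 0 -> 0 < (z^T *m z) 0 0.
Proof.
move=> z0; rewrite lt_def dotcv_ge0 andbT; apply: contraNneq z0 => /eqP.
rewrite mxE psumr_eq0 => [/allP z0|i _]; last by rewrite mxE -expr2 sqr_ge0.
apply/eqP/colP => i; have := z0 i; rewrite mem_index_enum => /(_ isT).
by rewrite /= !mxE -expr2 sqrf_eq0 => /eqP.
Qed.

(** Over [R[i]] the matrix is hermitian, so the spectral theorem diagonalizes it; [s] lists its
    eigenvalues, which are real, and q(A) is conjugate to the diagonal matrix of the values of q on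
    [s]. *)
Lemma symmetric_annihilator n (A : 'M[R]_n.+1) : A^T = A -> mx_ge 1 A ->
  exists s : seq R, (forall d, d \in s -> 1 <= d) /\
    forall q : {poly R}, (forall d, d \in s -> q.[d] = 0) -> horner_mx A q = 0.
Proof.
move=> symA geA; pose f : {rmorphism R -> R[i]} := real_complex R.
pose AC := map_mx f A.
have realA : AC \is a realmx.
  by apply/mxOverP => i j; rewrite mxE; apply/complex_realP; exists (A i j).
have symAC : AC \is symmetricmx.
  by apply/is_hermitianmxP; rewrite expr0 scale1r map_mx_id // map_trmx symA.
have hermA : AC \is hermsymmx by apply: realsym_hermsym.
have /hermitian_normalmx/orthomx_spectralP AE := hermA.
have /mxOverP Dreal := hermitian_spectral_diag_real hermA.
set P := spectralmx AC in AE; set D := spectral_diag AC in AE Dreal.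
have Pu : P \in unitmx by apply: spectral_unit.
have DE i : D 0 i = f (complex.Re (D 0 i)).
  by have /complex_realP[x ->] := Dreal 0 i.
exists [seq complex.Re (D 0 i) | i <- enum 'I_n.+1]; split.
- move=> _ /mapP[i _ ->]; set d := complex.Re _.
  (* Row i of the diagonalizing matrix [P] is a left eigenvector. *)
  have eigAC : eigenvalue AC (f d).
    apply/eigenvalueP; exists (row i P); last first.
      apply/eqP => r0; have := congr1 (mulmx^~ (invmx P)) r0.
      rewrite mul0mx -row_mul mulmxV // => /rowP/(_ i)/eqP.
      by rewrite !mxE eqxx oner_eq0.
    rewrite -row_mul {1}AE !mulmxA mulmxV // mul1mx row_mul row_diag_mx -scalemxAl.
    by rewrite -rowE DE.
  (* Being a real root of the characteristic polynomial, d also has a real eigenvector, on which the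
     bound [mx_ge 1 A] reads 1 <= d. *)
  have : eigenvalue A d.
    move: eigAC; rewrite !eigenvalue_root_char /AC -map_char_poly.
    by rewrite fmorph_root.
  case/eigenvalueP => v vA v0; have := geA v^T.
  rewrite trmxK vA -scalemxAl [leRHS]mxE => H.
  have vv : 0 < (v *m v^T) 0 0.
    by have := dotcv_gt0 (z := v^T); rewrite trmxK; apply; rewrite trmx_eq0.
  by rewrite ler_pM2r in H.
- move=> q q0; apply: (map_mx_inj (f := f)).
  rewrite map_horner_mx -/AC AE horner_mx_uconjC // horner_mx_diag.
  rewrite (_ : map_mx _ D = 0) ?linear0 ?mulmx0 ?mul0mx ?map_mx0 //.
  apply/rowP => i; rewrite !mxE DE horner_map q0 ?rmorph0 //.
  by apply/mapP; exists i => //; rewrite mem_enum.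
Qed.

Lemma poly_interpolation (phi : R -> R) (s : seq R) :
  exists q : {poly R}, forall d, d \in s -> q.[d] = phi d.
Proof.
elim: s => [|d s [q qP]]; first by exists 0.
have [ds|ds] := boolP (d \in s).
  by exists q => e; rewrite inE => /orP[/eqP->|]; apply: qP.
(* Newton interpolation: a multiple of [m] corrects the value at the new node and vanishes at the
   old ones. *)
pose m := \prod_(e <- s) ('X - e%:P).
have md : m.[d] != 0 by have := root_prod_XsubC s d; rewrite rootE (negbTE ds) => ->.
exists (q + ((phi d - q.[d]) / m.[d]) *: m) => e; rewrite inE => /orP[/eqP->|es].
  by rewrite !hornerE /= divfK // addrC subrK.
have : root m e by rewrite root_prod_XsubC.
by rewrite !hornerE => /eqP ->; rewrite mulr0 addr0 qP.
Qed.

Lemma horner_mx_tr n (A : 'M[R]_n.+1) q : (horner_mx A q)^T = horner_mx A^T q.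
Proof.
elim/poly_ind: q => [|q c IH]; first by rewrite !rmorph0 trmx0.
rewrite !rmorphD !rmorphM /= !horner_mx_X !horner_mx_C linearD /= tr_scalar_mx.
by rewrite trmx_mul IH; congr (_ + _); apply: comm_mx_horner.
Qed.

(* The class Q is where the subalgebra of block circulant matrices will be plugged in. *)
Lemma sqrt_in_subalgebra n (A : 'M[R]_n) (Q : 'M[R]_n -> Prop) :
  A^T = A -> mx_ge 1 A -> Q A -> Q 1%:M ->
  (forall B C, Q B -> Q C -> Q (B + C)) ->
  (forall B C, Q B -> Q C -> Q (B *m C)) ->
  (forall a B, Q B -> Q (a *: B)) ->
  exists W T : 'M[R]_n, [/\ Q W, Q T, W^T = W,
    (1%:M + W *m W) *m (1%:M + W *m W) = A & T *m (1%:M + W *m W) = 1%:M].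
Proof.
case: n => [|n] in A Q *.
  by move=> *; exists 1%:M, 1%:M; split=> //; apply/matrixP; case.
move=> symA geA QA Q1 QD QM QZ.
have QP q : Q (horner_mx A q).
  elim/poly_ind: q => [|q c IH].
    by rewrite rmorph0 -(scale0r 1%:M); apply: QZ.
  rewrite rmorphD rmorphM /= horner_mx_X horner_mx_C -scalemx1.
  by apply: QD; [apply: QM|apply: QZ].
have [s [s1 sP]] := symmetric_annihilator symA geA.
have sE q r : (forall d, d \in s -> q.[d] = r.[d]) -> horner_mx A q = horner_mx A r.
  move=> qr; apply/eqP; rewrite -subr_eq0 -rmorphB; apply/eqP/sP => d ds.
  by rewrite !hornerE qr ?subrr.
(* The root of A is sought as 1 + W W with W symmetric, which makes the bound S >= I immediate;
   hence w(d)^2 = sqrt d - 1, and d >= 1 makes this possible. The polynomial [t] yields the inverse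
   of the root inside the same subalgebra. *)
have [w wP] := poly_interpolation (fun d => Num.sqrt (Num.sqrt d - 1)) s.
have [t tP] := poly_interpolation (fun d => (Num.sqrt d)^-1) s.
have rP d : d \in s -> (1 + w * w).[d] = Num.sqrt d.
  move=> ds; rewrite !hornerE wP // -expr2 sqr_sqrtr ?(addrC 1) ?subrK //.
  by rewrite subr_ge0 -{1}sqrtr1 ler_wsqrtr // s1.
have WE : 1%:M + horner_mx A w *m horner_mx A w = horner_mx A (1 + w * w).
  by rewrite rmorphD (rmorph1 (horner_mx A)) rmorphM.
exists (horner_mx A w), (horner_mx A t); split=> //.
- by rewrite horner_mx_tr symA.
- rewrite WE -[LHS]rmorphM -[RHS]horner_mx_X; apply: sE => d ds.
  rewrite hornerM rP // hornerX -expr2 sqr_sqrtr //.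
  by rewrite (le_trans ler01) // s1.
- rewrite WE -[LHS]rmorphM -[RHS](rmorph1 (horner_mx A)); apply: sE => d ds.
  rewrite hornerM rP // tP // hornerC mulVf // lt0r_neq0 // sqrtr_gt0.
  by rewrite (lt_le_trans ltr01) // s1.
Qed.

Lemma mx_ge_1_sqr n (W : 'M[R]_n) : W^T = W -> mx_ge 1 (1%:M + W *m W).
Proof.
move=> symW z; rewrite mul1r mulmxDr mulmxDl mulmx1 [leRHS]mxE lerDl.
rewrite mulmxA -mulmxA -{1}symW -trmx_mul; exact: dotcv_ge0.
Qed.

(** Both traces add up a quadratic form over the columns of [X]. *)
Lemma mx_ge_trace m n c (S : 'M[R]_n) (X : 'M[R]_(n, m)) : mx_ge c S ->
  c * \tr (X^T *m X) <= \tr (X^T *m S *m X).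
Proof.
move=> Sc; rewrite /mxtrace mulr_sumr; apply: ler_sum => i _.
have E (M : 'M[R]_n) : ((col i X)^T *m M *m col i X) 0 0 = (X^T *m M *m X) i i.
  by rewrite tr_col -row_mul !mxE; apply: eq_bigr => j _; rewrite !mxE.
by have := E 1%:M; rewrite !mulmx1 => <-; rewrite -E; exact: Sc.
Qed.

Lemma mxtrace_sqr_ge m n (X : 'M[R]_(m, n)) i j : X i j ^+ 2 <= \tr (X^T *m X).
Proof.
rewrite /mxtrace (bigD1 j) //= mxE (bigD1 i) //= mxE -expr2 -addrA lerDl.
rewrite addr_ge0 // sumr_ge0 // => k _; last rewrite mxE sumr_ge0 // => i' _.
  by rewrite mxE -expr2 sqr_ge0.
by rewrite mxE -expr2 sqr_ge0.
Qed.

Lemma mxtrace_sqr_eq0 m n (X : 'M[R]_(m, n)) : \tr (X^T *m X) <= 0 -> X = 0.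
Proof.
move=> X0; apply/matrixP => i j; apply/eqP; rewrite mxE -sqrf_eq0.
by rewrite eq_le sqr_ge0 andbT (le_trans (mxtrace_sqr_ge X i j)).
Qed.

(** The term with [M] contributes a nonnegative trace; the term with [S] becomes tr(X S X^T) by
    cyclicity, which is at least the squared Frobenius norm of X. *)
Lemma sylvester_coercive n (M S X : 'M[R]_n) : mx_ge 0 M -> mx_ge 1 S ->
  \tr (X^T *m X) <= \tr (X^T *m (M *m X + X *m S)).
Proof.
move=> M0 S1; rewrite mulmxDr mxtraceD -[leLHS]add0r lerD //.
  by rewrite mulmxA -[leLHS](mul0r (\tr (X^T *m X))) mx_ge_trace.
have := mx_ge_trace X^T S1; rewrite trmxK mul1r mxtrace_mulC => /le_trans; apply.
by rewrite mxtrace_mulC.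
Qed.

(** In the Frobenius inner product, coercivity gives |X|^2 <= <X,B>, while |X - B|^2 >= 0 gives
    2<X,B> <= |X|^2 + |B|^2. *)
Lemma sylvester_bound n (M S X : 'M[R]_n) (B := M *m X + X *m S) :
  mx_ge 0 M -> mx_ge 1 S -> \tr (X^T *m X) <= \tr (B^T *m B).
Proof.
move=> M0 S1; have := sylvester_coercive X M0 S1; rewrite -/B => XB.
have : 0 <= \tr ((X - B)^T *m (X - B)).
  rewrite /mxtrace sumr_ge0 // => i _; rewrite mxE sumr_ge0 // => j _.
  by rewrite mxE -expr2 sqr_ge0.
rewrite [(X - B)^T]linearB /= mulmxBl !mulmxBr !linearB /=.
rewrite -[\tr (B^T *m X)]mxtrace_tr trmx_mul trmxK; lra.
Qed.

Lemma sylvester_inj n (M S X : 'M[R]_n) : mx_ge 0 M -> mx_ge 1 S ->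
  M *m X + X *m S = 0 -> X = 0.
Proof.
move=> M0 S1 e; apply: mxtrace_sqr_eq0.
by have := sylvester_coercive X M0 S1; rewrite e mulmx0 linear0.
Qed.

Lemma mx_ge_sub n c d (S : 'M[R]_n) : c <= d -> mx_ge d S -> mx_ge c S.
Proof.
move=> cd Sd z; apply: le_trans (Sd z); apply: ler_wpM2r => //; exact: dotcv_ge0.
Qed.

(** The difference X = S' - S satisfies S' X + X S = S'^2 - S^2 = 0, so it lies in the kernel of an
    injective Sylvester operator. *)
Lemma sqrt_mx_uniq n (S S' : 'M[R]_n) :
  mx_ge 0 S' -> mx_ge 1 S -> S' *m S' = S *m S -> S' = S.
Proof.
move=> S'0 S1 e; apply/eqP; rewrite -subr_eq0; apply/eqP.
apply: sylvester_inj S'0 S1 _.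
by rewrite mulmxBr mulmxBl e addrA subrK subrr.
Qed.

Lemma mx_ge_1_unit n (S : 'M[R]_n) : mx_ge 1 S -> S \in unitmx.
Proof.
move=> S1; rewrite -row_free_unit; apply: inj_row_free => v vS.
apply/eqP/negPn/negP => v0; have := S1 v^T; rewrite trmxK vS mul0mx mul1r [leRHS]mxE.
by have := dotcv_gt0 (z := v^T); rewrite trmxK trmx_eq0 => /(_ v0) /lt_geF ->.
Qed.

End MatrixRoot.

(** * Smooth maps, coordinatewise *)

Section Smooth.
Variables (R : realType) (U : normedModType R).
Implicit Types (f g : U -> R) (k : nat).

(* Unlike [Ck], [realCk] carries continuity at every order, which makes it
   decreasing in [k] without a mean value argument. *)
Fixpoint realCk k (f : U -> R) : Prop :=
  continuous f /\
  if k is k'.+1 then (forall x v, derivable f x v) /\ forall v, realCk k' ('D_v f)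
  else True.

Lemma realCk_continuous k f : realCk k f -> continuous f.
Proof. by case: k => [|k] []. Qed.

Lemma realCk_down k f : realCk k.+1 f -> realCk k f.
Proof.
elim: k f => [|k IH] f [cf [df Df]]; split=> //; split=> // v.
exact/IH/Df.
Qed.

Lemma realCk_cst k (c : R) : realCk k (fun=> c).
Proof.
elim: k c => [|k IH] c; split=> //; try by move=> x; apply: cvg_cst.
split=> [x v|v]; first exact: derivable_cst.
rewrite (_ : 'D_v _ = fun=> 0) //.
by apply/funext => x; rewrite derive_cst.
Qed.

Lemma realCk_add k f g : realCk k f -> realCk k g -> realCk k (fun x => f x + g x).
Proof.
elim: k f g => [|k IH] f g [cf Hf] [cg Hg].
  by split=> // x; apply: cvgD; [apply: cf|apply: cg].
split; first by move=> x; apply: cvgD; [apply: cf|apply: cg].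
case: Hf Hg => [df Df] [dg Dg]; split=> [x v|v].
  exact: (derivableD (df x v) (dg x v)).
rewrite (_ : 'D_v _ = fun x => 'D_v f x + 'D_v g x).
  by apply: IH; [apply: Df|apply: Dg].
by apply/funext => x; rewrite -deriveD.
Qed.

Lemma realCk_mul k f g : realCk k f -> realCk k g -> realCk k (fun x => f x * g x).
Proof.
elim: k f g => [|k IH] f g Hf Hg.
  by split=> // x; apply: cvgM; [apply: Hf.1|apply: Hg.1].
split; first by move=> x; apply: cvgM; [apply: Hf.1|apply: Hg.1].
(* The Leibniz rule involves the factors themselves, which are needed at order k. *)
have [fk gk] := (realCk_down Hf, realCk_down Hg).
case: Hf Hg => [_ [df Df]] [_ [dg Dg]]; split=> [x v|v].
  exact: (derivableM (df x v) (dg x v)).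
rewrite (_ : 'D_v _ = fun x => f x * 'D_v g x + g x * 'D_v f x).
  by apply: realCk_add; [apply: IH fk (Dg v)|apply: IH gk (Df v)].
by apply/funext => x; rewrite [LHS](deriveM (df x v) (dg x v)).
Qed.

Lemma realCk_inv k f : (forall x, f x != 0) -> realCk k f -> realCk k (fun x => (f x)^-1).
Proof.
move=> f0; elim: k => [|k IH] Hf.
  by split=> // x; apply: cvgV => //; apply: Hf.1.
split; first by move=> x; apply: cvgV => //; apply: Hf.1.
have fk := IH (realCk_down Hf); case: Hf => [_ [df Df]].
split=> [x v|v]; first exact: derivableV.
rewrite (_ : 'D_v _ = fun x => (-1 * ((f x)^-1 * (f x)^-1)) * 'D_v f x).
  exact: realCk_mul (realCk_mul (realCk_cst k _) (realCk_mul fk fk)) (Df v).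
by apply/funext => x; rewrite deriveV // mulN1r -invfM -expr2.
Qed.

Lemma realCk_sum k (I : finType) (F : I -> U -> R) :
  (forall i, realCk k (F i)) -> realCk k (fun x => \sum_i F i x).
Proof.
move=> HF; elim: (index_enum I) => [|i s IH].
  by under eq_fun do rewrite big_nil; apply: realCk_cst.
by under eq_fun do rewrite big_cons; apply: realCk_add.
Qed.

Lemma realCk_prod k (I : finType) (F : I -> U -> R) :
  (forall i, realCk k (F i)) -> realCk k (fun x => \prod_i F i x).
Proof.
move=> HF; elim: (index_enum I) => [|i s IH].
  by under eq_fun do rewrite big_nil; apply: realCk_cst.
by under eq_fun do rewrite big_cons; apply: realCk_mul.
Qed.

Lemma derive_linear f : (forall a x y, f (a *: x + y) = a * f x + f y) ->
  forall x v, derivable f x v /\ 'D_v f x = f v.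
Proof.
move=> lf x v; have H : h^-1 *: ((f \o shift x) (h *: v) - f x) @[h --> 0^'] --> f v.
  apply: cvg_near_cst; near=> h; rewrite /= lf addrK [_ *: _]mulKf //.
  by near: h; exact: nbhs_dnbhs_neq.
by split; [apply/cvg_ex; exists (f v)|apply: cvg_lim].
Unshelve. all: by end_near. Qed.

Lemma realCk_linear k f : continuous f ->
  (forall a x y, f (a *: x + y) = a * f x + f y) -> realCk k f.
Proof.
move=> cf lf; case: k => [|k]; split=> //; split=> [x v|v].
  exact: (derive_linear lf x v).1.
rewrite (_ : 'D_v _ = fun=> f v); first exact: realCk_cst.
by apply/funext => x; apply: (derive_linear lf x v).2.
Qed.

Definition mxCk k m n (F : U -> 'M[R]_(m, n)) := forall i j, realCk k (fun x => F x i j).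

Lemma mxCk_cst k m n (M : 'M[R]_(m, n)) : mxCk k (fun=> M).
Proof. by move=> i j; apply: realCk_cst. Qed.

Lemma mxCk_add k m n (F G : U -> 'M[R]_(m, n)) :
  mxCk k F -> mxCk k G -> mxCk k (fun x => F x + G x).
Proof. by move=> HF HG i j; under eq_fun do rewrite mxE; apply: realCk_add. Qed.

Lemma mxCk_mul k m n p (F : U -> 'M[R]_(m, n)) (G : U -> 'M[R]_(n, p)) :
  mxCk k F -> mxCk k G -> mxCk k (fun x => F x *m G x).
Proof.
move=> HF HG i j; under eq_fun do rewrite mxE.
by apply: realCk_sum => c; apply: realCk_mul.
Qed.

Lemma mxCk_tr k m n (F : U -> 'M[R]_(m, n)) : mxCk k F -> mxCk k (fun x => (F x)^T).
Proof. by move=> HF i j; under eq_fun do rewrite mxE; apply: HF. Qed.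

Lemma realCk_det k n (F : U -> 'M[R]_n) : mxCk k F -> realCk k (fun x => \det (F x)).
Proof.
move=> HF; apply: realCk_sum => s; apply: realCk_mul; first exact: realCk_cst.
by apply: realCk_prod => i; apply: HF.
Qed.

(** Cramer's formula: the entries are cofactors divided by a nonvanishing determinant. *)
Lemma mxCk_invmx k n (F : U -> 'M[R]_n) : (forall x, F x \in unitmx) ->
  mxCk k F -> mxCk k (fun x => invmx (F x)).
Proof.
move=> Fu HF i j.
under eq_fun do rewrite /invmx Fu !mxE.
apply: realCk_mul.
  by apply: realCk_inv; [move=> x; rewrite -unitfE -unitmxE|apply: realCk_det].
apply: realCk_mul; first exact: realCk_cst.
by apply: realCk_det => a b; under eq_fun do rewrite !mxE; apply: HF.
Qed.

(** The matrix norm is the maximum over finitely many entries, and derivatives are taken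
    entrywise. *)
Lemma mxCk_Ck k m n (F : U -> 'M[R]_(m, n)) : mxCk k F -> Ck k F.
Proof.
elim: k F => [|k IH] F HF /=.
  move=> x; apply/cvgrPdist_le => /= e e0; near=> y.
  rewrite /Num.Def.normr/= mx_normrE (bigmax_le _ (ltW e0))//= => i _.
  rewrite !mxE; move: i; near: y; apply: filter_forall => i.
  exact: ((cvgrPdist_le _ _).1 ((HF i.1 i.2).1 x)).
have dF x v : derivable F x v.
  by apply/derivable_mxP => i j; exact: (HF i j).2.1.
split=> // v; apply: IH => i j.
rewrite (_ : (fun x => _) = 'D_v (fun x => F x i j)); first exact: (HF i j).2.2.
by apply/funext => x; rewrite derive_mx // mxE.
Unshelve. all: by end_near. Qed.

End Smooth.

(** * Smoothness of the square root *)

Section SylvesterOperator.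
Variables (R : realType) (n : nat).

(** The matrix of X |-> M X + X S on vectorized matrices; inverting the operator becomes [invmx],
    whose regularity is known. *)
Definition sylvester (M S : 'M[R]_n) : 'M[R]_(n * n) := lin_mulmx M + lin_mulmxr S.

Lemma mul_vec_sylvester M S X : mxvec X *m sylvester M S = mxvec (M *m X + X *m S).
Proof. by rewrite mulmxDr !mul_vec_lin linearD. Qed.

Lemma sylvester_unit M S : mx_ge 0 M -> mx_ge 1 S -> sylvester M S \in unitmx.
Proof.
move=> M0 S1; rewrite -row_free_unit; apply: inj_row_free => v.
rewrite -(vec_mxK v) mul_vec_sylvester => /(canRL mxvecK).
by rewrite linear0 => /(sylvester_inj M0 S1) ->; rewrite linear0.
Qed.

Lemma mxCk_sylvester (U : normedModType R) k (F G : U -> 'M[R]_n) :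
  mxCk k F -> mxCk k G -> mxCk k (fun x => sylvester (F x) (G x)).
Proof.
move=> HF HG; apply: mxCk_add => i j; case/mxvec_indexP: j => a b.
  under eq_fun do rewrite mxE /= mxvecE.
  by apply: mxCk_mul => //; apply: mxCk_cst.
under eq_fun do rewrite mxE /= mxvecE.
by apply: mxCk_mul => //; apply: mxCk_cst.
Qed.

End SylvesterOperator.

Section SmoothRoot.
Variables (R : realType) (U : normedModType R) (n : nat).
Variables (A S : U -> 'M[R]_n).
Hypothesis (smA : forall k, mxCk k A) (SS : forall x, S x *m S x = A x).
Hypothesis (S1 : forall x, mx_ge 1 (S x)).

Let S0 x : mx_ge 0 (S x). Proof. exact: mx_ge_sub ler01 (S1 x). Qed.

Lemma root_sylvester x y :
  S y *m (S y - S x) + (S y - S x) *m S x = A y - A x.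
Proof. by rewrite mulmxBr mulmxBl addrA subrK !SS. Qed.

(** By [root_sylvester] and [sylvester_bound], the Frobenius distance from S(y) to S(x) is at most
    that from A(y) to A(x). *)
Lemma root_continuous : mxCk 0 S.
Proof.
move=> i j; split=> // x; apply/cvgrPdist_lt => e e0.
have cN : realCk 0 (fun y => \tr ((A y - A x)^T *m (A y - A x))).
  have sB : mxCk 0 (fun y => A y - A x) by apply: mxCk_add; [apply: smA|apply: mxCk_cst].
  by apply: realCk_sum => c; apply: mxCk_mul => //; apply: mxCk_tr.
have /cvgrPdist_lt/(_ (e ^+ 2)) := (realCk_continuous cN) x.
rewrite exprn_gt0 // subrr mulmx0 linear0 => /(_ isT); apply: filterS => y.
rewrite sub0r normrN => lt_e.
have le_e : (S y i j - S x i j) ^+ 2 < e ^+ 2.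
  apply: le_lt_trans (le_lt_trans (ler_norm _) lt_e).
  have := mxtrace_sqr_ge (S y - S x) i j; rewrite !mxE => /le_trans; apply.
  by rewrite -root_sylvester; exact: sylvester_bound.
rewrite distrC -(ltr_pXn2r (n := 2)) ?nnegrE ?normr_ge0 ?ltW //.
by rewrite real_normK ?num_real.
Qed.

(** The difference quotient of S is exactly that of A multiplied by the inverse Sylvester matrix at
    (S(y), S(x)); continuity of S lets y tend to x. *)
Lemma root_derive i j x v (F := fun x => S x i j) :
  derivable F x v /\
  'D_v F x = \sum_c 'D_v (fun y => mxvec (A y) 0 c) x *
     invmx (sylvester (S x) (S x)) c (mxvec_index i j).
Proof.
have smK : mxCk 0 (fun y => invmx (sylvester (S y) (S x))).
  apply: mxCk_invmx; first by move=> y; apply: sylvester_unit.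
  by apply: mxCk_sylvester; [exact: root_continuous|exact: mxCk_cst].
have dA c : derivable (fun y => mxvec (A y) 0 c) x v.
  case/mxvec_indexP: c => a b; under eq_fun do rewrite mxvecE.
  exact: (smA 1 a b).2.1.
set l := (RHS).
have H : h^-1 *: ((F \o shift x) (h *: v) - F x) @[h --> 0^'] --> l.
  have -> : (fun h : R => h^-1 *: ((F \o shift x) (h *: v) - F x)) =
    (fun h => \sum_c (h^-1 *: (mxvec (A (h *: v + x)) 0 c - mxvec (A x) 0 c)) *
      invmx (sylvester (S (h *: v + x)) (S x)) c (mxvec_index i j)).
    apply/funext => h /=; set y := h *: v + x.
    have -> : F y - F x =
        (mxvec (A y - A x) *m invmx (sylvester (S y) (S x))) 0 (mxvec_index i j).
      rewrite -root_sylvester -mul_vec_sylvester mulmxK ?sylvester_unit //.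
      by rewrite mxvecE !mxE.
    rewrite mxE scaler_sumr; apply: eq_bigr => c _.
    by rewrite linearB /= !mxE scalerAl.
  apply: cvg_big => [|c _]; first exact: add_continuous.
  apply: cvgM; first exact: dA.
  have hx : (h *: v + x) @[h --> (0 : R)^'] --> x.
    rewrite -{2}[x]add0r -(scale0r v); apply: cvgD; last exact: cvg_cst.
    by apply: cvgZr_tmp; apply: cvg_within.
  exact: (cvg_comp _ _ hx ((smK c (mxvec_index i j)).1 x)).
by split; [apply/cvg_ex; exists l|apply: cvg_lim].
Qed.

(** Bootstrap: the formula for DS contains S and DA but not DS, so S of order k makes DS of order
    k. *)
Lemma root_smooth k : mxCk k S.
Proof.
elim: k => [|k IH]; first exact: root_continuous.
move=> i j; split; first exact: (root_continuous i j).1.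
split=> [x v|v]; first exact: (root_derive i j x v).1.
rewrite (_ : 'D_v _ = fun x => \sum_c 'D_v (fun y => mxvec (A y) 0 c) x *
     invmx (sylvester (S x) (S x)) c (mxvec_index i j)); last first.
  by apply/funext => x; rewrite (root_derive i j x v).2.
apply: realCk_sum => c; apply: realCk_mul; last first.
  apply: mxCk_invmx; first by move=> x; apply: sylvester_unit.
  exact: mxCk_sylvester.
case/mxvec_indexP: c => a b.
have -> : (fun y => mxvec (A y) 0 (mxvec_index a b)) = (fun y => A y a b).
  by apply/funext => y; rewrite mxvecE.
exact: (smA k.+1 a b).2.2.
Qed.

End SmoothRoot.

(** Replacing h by -h negates the difference quotient at 0, so its limit equals its own opposite. *)
Lemma derive_even (R : realType) (U : normedModType R) (f : U -> R) (v : U) :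
  (forall x, f (- x) = f x) -> derivable f 0 v -> 'D_v f 0 = 0.
Proof.
move=> fE /cvg_ex[l fl].
have -> : 'D_v f 0 = l by apply: cvg_lim.
suff : l = - l by lra.
apply: (cvg_unique _ fl) => //.
have -> : (fun h : R => h^-1 *: ((f \o shift 0) (h *: v) - f 0)) =
   (fun h => - (fun h : R => h^-1 *: ((f \o shift 0) (h *: v) - f 0)) (- h)).
  apply/funext => h /=; rewrite !addr0 scaleNr fE invrN scaleNr opprK //.
apply: cvgN; rewrite -[X in X^'](oppr0) in fl.
rewrite dnbhsN in fl.
move=> B /fl[C HC e]; apply: filterS HC => y Cy.
have : (-%R @` C) (- y) by exists y.
by rewrite e.
Qed.

(** * The tensor algebra and the retraction *)

Lemma idxK a b (i : 'I_a) (j : 'I_b) : idx (mxvec_index i j) = (i, j).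
Proof. by rewrite /idx /mxvec_index cast_ordK enum_rankK. Qed.

Lemma sum_mxvec_index (V : nmodType) a b (F : 'I_(a * b) -> V) :
  \sum_c F c = \sum_i \sum_j F (mxvec_index i j).
Proof.
rewrite (reindex _ (curry_mxvec_bij _ _)) pair_bigA /=.
by apply: eq_bigr => -[].
Qed.

(** Slice indices form the cyclic group Z/(l+1), so circulant identities reduce to group identities;
    having no slices is a separate trivial case. *)
Lemma subordE l (i j : 'I_l.+1) : subord i j = i - j.
Proof. by apply: val_inj; rewrite /= modnDmr addnBA // ltnW. Qed.

Lemma negordE l (i : 'I_l.+1) : negord i = - i.
Proof. exact: val_inj. Qed.

Section TensorAlgebra.
Variable R : realType.

Lemma tensorP n p l (A B : tensor R n p l) :
  (forall i k j, A i (mxvec_index k j) = B i (mxvec_index k j)) -> A = B.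
Proof. by move=> AB; apply/matrixP => i c; case/mxvec_indexP: c => k j; apply: AB. Qed.

Lemma blockP n p l (A B : 'M[R]_(l * n, l * p)) :
  (forall a i b j, A (mxvec_index a i) (mxvec_index b j)
                 = B (mxvec_index a i) (mxvec_index b j)) -> A = B.
Proof.
move=> AB; apply/matrixP => r c.
by case/mxvec_indexP: r => a i; case/mxvec_indexP: c => b j; apply: AB.
Qed.

Lemma bcircE n p l (A : tensor R n p l) a i b j :
  bcirc A (mxvec_index a i) (mxvec_index b j) = A i (mxvec_index (subord a b) j).
Proof. by rewrite !mxE !idxK. Qed.

Lemma tunfoldE n p l (A : tensor R n p l) k i j :
  tunfold A (mxvec_index k i) j = A i (mxvec_index k j).
Proof. by rewrite !mxE !idxK. Qed.

Lemma tfoldE n p l (M : 'M[R]_(l * n, p)) k i j :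
  tfold M i (mxvec_index k j) = M (mxvec_index k i) j.
Proof. by rewrite !mxE !idxK. Qed.

Lemma tfoldK n p l (M : 'M[R]_(l * n, p)) : tunfold (tfold M) = M.
Proof.
apply/matrixP => r j; case/mxvec_indexP: r => k i.
by rewrite tunfoldE tfoldE.
Qed.

Lemma tunfoldK n p l (A : tensor R n p l) : tfold (tunfold A) = A.
Proof. by apply: tensorP => i k j; rewrite tfoldE tunfoldE. Qed.

Lemma ttrE n p l (A : tensor R n p l) i k j :
  ttr A j (mxvec_index k i) = A i (mxvec_index (negord k) j).
Proof. by rewrite !mxE !idxK. Qed.

Lemma tidE p l i (k : 'I_l) j :
  tid R p l i (mxvec_index k j) = (val k == 0%N)%:R *+ (i == j).
Proof. by rewrite !mxE idxK /=; case: eqP => _; rewrite !mxE // mul0rn. Qed.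

Lemma tmulE n m p l (A : tensor R n m l) (B : tensor R m p l) i k j :
  tmul A B i (mxvec_index k j) =
  \sum_b \sum_c A i (mxvec_index (subord k b) c) * B c (mxvec_index b j).
Proof.
rewrite tfoldE mxE sum_mxvec_index; apply: eq_bigr => b _; apply: eq_bigr => c _.
by rewrite bcircE tunfoldE.
Qed.

Lemma tunfold_tmul n m p l (A : tensor R n m l) (B : tensor R m p l) :
  tunfold (tmul A B) = bcirc A *m tunfold B.
Proof. exact: tfoldK. Qed.

Lemma bcirc_entry n p l (A : tensor R n p l.+1) i k j :
  A i (mxvec_index k j) = bcirc A (mxvec_index k i) (mxvec_index 0 j).
Proof. by rewrite bcircE subordE subr0. Qed.

Lemma bcirc_inj n p l : injective (@bcirc R n p l).
Proof.
case: l => [|l] A B AB; apply: tensorP => i k j; first by case: k.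
by rewrite (bcirc_entry A) AB -bcirc_entry.
Qed.

Lemma bcirc_add n p l (A B : tensor R n p l) : bcirc (A + B) = bcirc A + bcirc B.
Proof. by apply: blockP => a i b j; rewrite !bcircE !mxE !idxK. Qed.

Lemma bcirc_scale n p l x (A : tensor R n p l) : bcirc (x *: A) = x *: bcirc A.
Proof. by apply: blockP => a i b j; rewrite !bcircE !mxE !idxK. Qed.

Lemma bcirc_mul n m p l (A : tensor R n m l) (B : tensor R m p l) :
  bcirc (tmul A B) = bcirc A *m bcirc B.
Proof.
case: l => [|l] in A B *; apply: blockP => a i b j; first by case: a.
(* Shifting the summation index by b uses (a - b) - (c - b) = a - c. *)
rewrite bcircE tmulE [RHS]mxE sum_mxvec_index (reindex_inj (addIr (- b))) /=.
apply: eq_bigr => c _; apply: eq_bigr => d _.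
by rewrite !bcircE !subordE opprB addrA subrK.
Qed.

Lemma bcirc_tr n p l (A : tensor R n p l) : bcirc (ttr A) = (bcirc A)^T.
Proof.
case: l => [|l] in A *; apply: blockP => a i b j; first by case: a.
by rewrite [RHS]mxE !bcircE ttrE negordE !subordE opprB.
Qed.

Lemma bcirc_id p l : bcirc (tid R p l) = 1%:M.
Proof.
case: l => [|l]; apply: blockP => a i b j; first by case: a.
have ab : (val (a - b) == 0%N) = (a == b) by rewrite -subr_eq0.
rewrite bcircE tidE subordE ab mxE.
have -> : (mxvec_index a i == mxvec_index b j) = (a == b) && (i == j).
  by apply/eqP/andP => [/(congr1 (@idx _ _))|[/eqP-> /eqP->] //];
     rewrite !idxK => -[-> ->].
by case: (a == b); case: (i == j).
Qed.

Lemma tmulr1 n p l (A : tensor R n p l) : tmul A (tid R p l) = A.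
Proof. by apply: bcirc_inj; rewrite bcirc_mul bcirc_id mulmx1. Qed.

Lemma tinner_tunfold p l (Z W : tensor R p 1 l) :
  tinner Z W = ((tunfold Z)^T *m tunfold W) 0 0.
Proof.
rewrite mxE sum_mxvec_index exchange_big; apply: eq_bigr => i _.
rewrite sum_mxvec_index; apply: eq_bigr => k _.
by rewrite big_ord1 mxE !tunfoldE.
Qed.

Lemma tsym_bcirc p l (A : tensor R p p l) : tsym A <-> (bcirc A)^T = bcirc A.
Proof. by rewrite -bcirc_tr; split=> [->//|/bcirc_inj]. Qed.

Lemma tpsd_bcirc p l (A : tensor R p p l) :
  tpsd A <-> (bcirc A)^T = bcirc A /\ mx_ge 0 (bcirc A).
Proof.
split=> -[/tsym_bcirc sA A0]; split=> //; try exact/tsym_bcirc.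
  move=> z; have := A0 (tfold z).
  by rewrite tinner_tunfold tunfold_tmul tfoldK mul0r mulmxA.
move=> Z; have := A0 (tunfold Z).
by rewrite tinner_tunfold tunfold_tmul mul0r mulmxA.
Qed.

Lemma tpd_bcirc p l (A : tensor R p p l) :
  tsym A -> mx_ge 1 (bcirc A) -> tpd A.
Proof.
move=> sA A1; split=> // Z Z0; rewrite tinner_tunfold tunfold_tmul mulmxA.
apply: lt_le_trans (A1 _); rewrite mul1r dotcv_gt0 //.
apply: contra_neq Z0 => Z0; rewrite -(tunfoldK Z) Z0.
by apply/matrixP => i j; rewrite !mxE.
Qed.

(** * The tensor square root and its inverse *)

Section Root.
Variables (p l : nat) (A : tensor R p p l).
Hypotheses (symA : tsym A) (A1 : mx_ge 1 (bcirc A)).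

(** Transfers the matrix root to [tsqrt] and [tinvsqrt]: existence shows that the chosen values meet
    their specifications, and uniqueness identifies them. *)
Lemma tsqrt_spec :
  [/\ (bcirc (tsqrt A))^T = bcirc (tsqrt A), mx_ge 1 (bcirc (tsqrt A)),
      bcirc (tsqrt A) *m bcirc (tsqrt A) = bcirc A
    & bcirc (tinvsqrt A) = invmx (bcirc (tsqrt A))].
Proof.
have /tsym_bcirc symbA := symA.
have [|||||W [T [[w wE] [t tE] symW W2 TW]]] :=
  sqrt_in_subalgebra (Q := fun M => exists B : tensor R p p l, M = bcirc B) symbA A1.
- by exists A.
- by exists (tid R p l); rewrite bcirc_id.
- by move=> _ _ [B ->] [C ->]; exists (B + C); rewrite bcirc_add.
- by move=> _ _ [B ->] [C ->]; exists (tmul B C); rewrite bcirc_mul.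
- by move=> a _ [B ->]; exists (a *: B); rewrite bcirc_scale.
pose S := tid R p l + tmul w w.
have SE : bcirc S = 1%:M + W *m W by rewrite bcirc_add bcirc_mul bcirc_id wE.
have S1 : mx_ge 1 (bcirc S) by rewrite SE; exact: mx_ge_1_sqr.
have symS : (bcirc S)^T = bcirc S by rewrite SE linearD /= trmx1 trmx_mul symW.
have SA : tmul S S = A by apply: bcirc_inj; rewrite bcirc_mul SE.
(* A witness exists, so [xget] does not fall back to its default 0. *)
have : [set S | tpsd S /\ tmul S S = A] (tsqrt A).
  apply: xgetPex; exists S; split=> //.
  by apply/tpsd_bcirc; split=> //; exact: mx_ge_sub ler01 S1.
move=> [/tpsd_bcirc[_ s0] s2].
(* The choice is only known to be semidefinite; uniqueness gives it the bound S >= I. *)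
have sAE : tsqrt A = S.
  by apply: bcirc_inj; apply: sqrt_mx_uniq => //; rewrite -!bcirc_mul s2 SA.
rewrite sAE; split=> //; first by rewrite -bcirc_mul SA.
have Su := mx_ge_1_unit S1.
have : [set B | tmul (tsqrt A) B = tid R p l /\ tmul B (tsqrt A) = tid R p l]
  (tinvsqrt A).
  apply: xgetPex; exists t; rewrite sAE.
  have tS : bcirc t *m bcirc S = 1%:M by rewrite -tE SE.
  split; apply: bcirc_inj; rewrite bcirc_mul bcirc_id //.
  exact: mulmx1C.
rewrite sAE => -[/(congr1 (@bcirc _ _ _ _))].
rewrite bcirc_mul bcirc_id => e _.
by rewrite -[LHS](mulKmx Su) e mulmx1.
Qed.

Lemma tinvsqrt_sandwich : (bcirc (tinvsqrt A))^T *m bcirc A *m bcirc (tinvsqrt A) = 1%:M.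
Proof.
have [symS S1 SS ->] := tsqrt_spec.
have Su := mx_ge_1_unit S1.
by rewrite trmx_inv symS -SS mulmxA mulVmx // mul1mx mulmxV.
Qed.

End Root.

Lemma tgram_sym n p l (V : tensor R n p l) : tsym (tid R p l + tmul (ttr V) V).
Proof.
apply/tsym_bcirc; rewrite bcirc_add bcirc_mul bcirc_tr bcirc_id.
by rewrite linearD /= trmx1 trmx_mul trmxK.
Qed.

Lemma tgram_ge n p l (V : tensor R n p l) :
  mx_ge 1 (bcirc (tid R p l + tmul (ttr V) V)).
Proof.
move=> z; rewrite bcirc_add bcirc_mul bcirc_tr bcirc_id mul1r mulmxDr mulmxDl.
rewrite mulmx1 [leRHS]mxE lerDl mulmxA -trmx_mul -mulmxA; exact: dotcv_ge0.
Qed.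

Lemma tinvsqrt1 p l : tinvsqrt (tid R p l) = tid R p l.
Proof.
have sym1 : tsym (tid R p l) by apply/tsym_bcirc; rewrite bcirc_id trmx1.
have ge1 : mx_ge 1 (bcirc (tid R p l)).
  by move=> z; rewrite bcirc_id mulmx1 mul1r.
apply: bcirc_inj; have [_ S1 SS ->] := tsqrt_spec sym1 ge1.
have -> : bcirc (tsqrt (tid R p l)) = bcirc (tid R p l).
  apply: sqrt_mx_uniq (mx_ge_sub ler01 S1) ge1 _.
  by rewrite SS bcirc_id mulmx1.
by rewrite bcirc_id invmx1.
Qed.

Lemma tmulr0 n m p l (A : tensor R n m l) : tmul A (0 : tensor R m p l) = 0.
Proof.
apply: tensorP => i k j; rewrite tmulE mxE big1 // => b _; rewrite big1 // => c _.
by rewrite mxE mulr0.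
Qed.

Lemma retrSt0 n p l (X : tensor R n p l) : retrSt X 0 = X.
Proof. by rewrite /retrSt tmulr0 !addr0 tinvsqrt1 tmulr1. Qed.

Lemma retrSt_Stiefel n p l (X V : tensor R n p l) : @Stiefel R n p l X ->
  (bcirc X)^T *m bcirc V + (bcirc V)^T *m bcirc X = 0 ->
  @Stiefel R n p l (retrSt X V).
Proof.
rewrite /Stiefel /= => /(congr1 (@bcirc _ _ _ _)).
rewrite bcirc_mul bcirc_tr bcirc_id => XX XV.
apply: bcirc_inj; rewrite bcirc_mul bcirc_tr bcirc_id.
(* Writing 1 as the sandwiched Gram matrix lets the outer factors cancel, leaving (X + V)^T (X + V)
   = I + V^T V. *)
rewrite -(tinvsqrt_sandwich (tgram_sym V) (tgram_ge V)) bcirc_mul trmx_mul.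
rewrite !mulmxA; congr (_ *m _); rewrite -!mulmxA; congr (_ *m _).
rewrite !bcirc_add bcirc_mul bcirc_tr bcirc_id [(_ + _)^T]linearD /= mulmxDl !mulmxDr XX.
by rewrite addrA -(addrA 1%:M) XV addr0.
Qed.

End TensorAlgebra.

(** * Product rule and the tangent condition *)

Lemma derive_mulmx (R : realType) (U : normedModType R) m n p
    (F : U -> 'M[R]_(m, n)) (G : U -> 'M[R]_(n, p)) x v
    (F' : 'M[R]_(m, n)) (G' : 'M[R]_(n, p)) :
  (forall i j, is_derive x v (fun y => F y i j) (F' i j)) ->
  (forall i j, is_derive x v (fun y => G y i j) (G' i j)) ->
  forall i j, is_derive x v (fun y => (F y *m G y) i j) ((F x *m G' + F' *m G x) i j).
Proof.
move=> HF HG i j.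
have -> : (fun y => (F y *m G y) i j) =
    \sum_(c < n) ((fun y => F y i c) * (fun y => G y c j)).
  apply/funext => y; rewrite mxE fct_sumE; exact: eq_bigr.
have -> : (F x *m G' + F' *m G x) i j =
    \sum_(c < n) (F x i c *: G' c j + G x c j *: F' i c).
  rewrite !mxE -big_split; apply: eq_bigr => c _ /=.
  by rewrite [in RHS]/GRing.scale /= [G x c j * _]mulrC.
by apply: is_derive_sum => c; apply: is_deriveM.
Qed.

(** Differentiate g^T g = I at 0 along a curve g representing V; the identity holds near 0, which
    suffices for the derivative. *)
Lemma tangentSt_bcirc (R : realType) n p l (X V : tensor R n p l) : tangentSt X V ->
  (bcirc X)^T *m bcirc V + (bcirc V)^T *m bcirc X = 0.
Proof.
move=> [g [sg [g0 [gSt gV]]]].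
have dg : derivable g 0 1 by exact: (sg 1%N).1.
have dgij i j : is_derive (0 : R) 1 (fun t => g t i j) (V i j).
  apply: DeriveDef; first exact: (derivable_mxP _ _ _).1 dg i j.
  by rewrite -gV derive_mx // mxE.
have dB i j : is_derive (0 : R) 1 (fun t => bcirc (g t) i j) (bcirc V i j).
  case/mxvec_indexP: i => a i; case/mxvec_indexP: j => b j; rewrite bcircE.
  by under eq_fun do rewrite bcircE; apply: dgij.
have dBT i j : is_derive (0 : R) 1 (fun t => (bcirc (g t))^T i j) ((bcirc V)^T i j).
  by rewrite mxE; under eq_fun do rewrite mxE; apply: dB.
rewrite -g0; apply/matrixP => i j; have [_ <-] := derive_mulmx dBT dB i j.
rewrite mxE (near_eq_derive (g := fun=> ((1%:M : 'M[R]_(l * p)) i j : R))) ?derive_cst //.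
near=> t; have : @Stiefel R n p l (g t) by near: t; exact: gSt.
move=> /(congr1 (@bcirc _ _ _ _)); rewrite bcirc_mul bcirc_tr bcirc_id.
by move=> ->.
Unshelve. all: by end_near. Qed.

(** * Smoothness and differential of the retraction *)

Section RetractionSmooth.
Variables (R : realType) (U : normedModType R) (n p l : nat).

Lemma mxCk_bcirc k m q (F : U -> tensor R m q l) :
  mxCk k F -> mxCk k (fun x => bcirc (F x)).
Proof.
move=> HF r c; case/mxvec_indexP: r => a i; case/mxvec_indexP: c => b j.
by under eq_fun do rewrite bcircE; apply: HF.
Qed.

Lemma mxCk_of_bcirc k m q (F : U -> tensor R m q l) :
  mxCk k (fun x => bcirc (F x)) -> mxCk k F.
Proof.
case: l F => [|l'] F HF i c; case/mxvec_indexP: c => a j; first by case: a.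
by under eq_fun do rewrite bcirc_entry; apply: HF.
Qed.

Lemma mxCk_tinvsqrt (V : U -> tensor R n p l) : (forall k, mxCk k V) ->
  forall k, mxCk k (fun x => tinvsqrt (tid R p l + tmul (ttr (V x)) (V x))).
Proof.
move=> smV k; apply: mxCk_of_bcirc.
pose A x := tid R p l + tmul (ttr (V x)) (V x).
pose S x := bcirc (tsqrt (A x)).
have spec x := tsqrt_spec (tgram_sym (V x)) (tgram_ge (V x)).
rewrite (_ : (fun x => _) = fun x => invmx (S x)); last first.
  by apply/funext => x; have [] := spec x.
apply: mxCk_invmx => [x|]; first by have [_ /mx_ge_1_unit] := spec x.
apply: (@root_smooth _ _ _ (fun x => bcirc (A x))) => [k'|x|x]; last 2 first.
- by have [] := spec x.
- by have [] := spec x.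
rewrite (_ : (fun x => _) = fun x => 1%:M + (bcirc (V x))^T *m bcirc (V x)).
  apply: mxCk_add; first exact: mxCk_cst.
  by apply: mxCk_mul; [apply: mxCk_tr|]; apply: mxCk_bcirc.
by apply/funext => x; rewrite bcirc_add bcirc_mul bcirc_tr bcirc_id.
Qed.

Lemma mxCk_retrSt (X V : U -> tensor R n p l) :
  (forall k, mxCk k X) -> (forall k, mxCk k V) ->
  forall k, mxCk k (fun x => retrSt (X x) (V x)).
Proof.
move=> smX smV k; apply: mxCk_of_bcirc.
under eq_fun do rewrite /retrSt bcirc_mul.
apply: mxCk_mul; apply: mxCk_bcirc; first exact: mxCk_add.
exact: mxCk_tinvsqrt.
Qed.

End RetractionSmooth.

Lemma mxCk_id (R : realType) m n k : mxCk k (fun M : 'M[R]_(m, n) => M).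
Proof.
move=> i j; apply: realCk_linear; first exact: coord_continuous.
by move=> a x y; rewrite !mxE.
Qed.

(* [V |-> (I + V^T V)^(-1/2)] is even, so it does not contribute to the derivative at 0. *)
Lemma derive_retrSt (R : realType) n p l (X V : tensor R n p l) :
  derivable (retrSt X) 0 V /\ 'D_V (retrSt X) 0 = V.
Proof.
have sm k : mxCk k (retrSt X).
  by apply: mxCk_retrSt => k'; [exact: mxCk_cst|exact: mxCk_id].
have dr : derivable (retrSt X) 0 V.
  by apply/derivable_mxP => i j; exact: (sm 1%N i j).2.1.
split=> //; apply: tensorP => i k j; rewrite derive_mx // mxE.
(* The t-product unfolds to [bcirc (X + W)] times [tunfold (G W)], to which the matrix product rule
   applies. *)
pose G (W : tensor R n p l) := tinvsqrt (tid R p l + tmul (ttr W) W).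
have dX a b : is_derive (0 : tensor R n p l) V (fun W => bcirc (X + W) a b) (bcirc V a b).
  case/mxvec_indexP: a => a c; case/mxvec_indexP: b => b d; rewrite bcircE.
  pose f (W : tensor R n p l) : R := W c (mxvec_index (subord a b) d).
  have lf x (Y Z : tensor R n p l) : f (x *: Y + Z) = x * f Y + f Z.
    by rewrite /f !mxE.
  have [dW DW] := derive_linear lf 0 V.
  rewrite -[V _ _]/(f V) -DW -[X in is_derive _ _ _ X]add0r.
  rewrite (_ : (fun W => _) = cst (X c (mxvec_index (subord a b) d)) + f); last first.
    by apply/funext => W; rewrite bcircE mxE.
  by apply: is_deriveD; exact: derivableP.
have smG : forall q, mxCk q G by apply: mxCk_tinvsqrt => q; exact: mxCk_id.
have dG a b : is_derive (0 : tensor R n p l) V (fun W => tunfold (G W) a b)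
    ((0 : 'M[R]_(l * p, p)) a b).
  case/mxvec_indexP: a => a c; under eq_fun do rewrite tunfoldE.
  have dGab := (smG 1%N c (mxvec_index a b)).2.1 0 V.
  have -> : (0 : 'M[R]_(l * p, p)) (mxvec_index a c) b = 0 by rewrite mxE.
  apply: (DeriveDef dGab); apply: derive_even dGab => W.
  suff -> : G (- W) = G W by [].
  rewrite /G (_ : tmul (ttr (- W)) (- W) = tmul (ttr W) W) //.
  apply: bcirc_inj; rewrite [LHS]bcirc_mul [RHS]bcirc_mul !bcirc_tr.
  by rewrite -[- W]scaleN1r bcirc_scale scaleN1r [(- _)^T]linearN mulNmx mulmxN opprK.
have [_] := derive_mulmx dX dG (mxvec_index k i) j.
rewrite mulmx0 add0r /G tmulr0 addr0 tinvsqrt1.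
rewrite -tunfold_tmul tmulr1 tunfoldE => <-; congr ('D_V _ 0).
by apply/funext => W; rewrite -tunfold_tmul tunfoldE.
Qed.

Theorem mainTheorem6 (R : realType) (n p l : nat) (hnp : (p <= n)%N) :
  (* well-defined: I + V^T*V is t-positive definite and R_X(V) lies in St *)
  (forall X V : tensor R n p l, @Stiefel R n p l X -> tangentSt X V ->
      tpd (tid R p l + tmul (ttr V) V) /\ @Stiefel R n p l (retrSt X V)) /\
  (* R_X(0_X) = X *)
  (forall X : tensor R n p l, @Stiefel R n p l X -> retrSt X 0 = X) /\
  (* D R_X(0_X) = id on T_X St *)
  (forall X V : tensor R n p l, @Stiefel R n p l X -> tangentSt X V ->
      derivable (retrSt X) 0 V /\ 'D_V (retrSt X) 0 = V) /\
  (* smoothness: the defining formula is C^oo on R^{npl} x R^{npl} *)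
  smooth (fun XV : tensor R n p l * tensor R n p l => retrSt XV.1 XV.2).
Proof.
split; first (move=> X V StX /tangentSt_bcirc tV; split; last exact: retrSt_Stiefel).
  exact: tpd_bcirc (tgram_sym V) (tgram_ge V).
split; first by move=> X _; exact: retrSt0.
split; first by move=> X V _ _; exact: derive_retrSt.
(* What remains is that the coordinates of both projections are continuous and linear, hence
   smooth. *)
move=> k; apply: mxCk_Ck; apply: mxCk_retrSt => {}k i j.
- apply: realCk_linear => [x|a x y]; last by rewrite !mxE.
  apply: (@continuous_comp _ _ _ fst (fun M : tensor R n p l => M i j)).
    exact: cvg_fst.
  exact: coord_continuous.
- apply: realCk_linear => [x|a x y]; last by rewrite !mxE.
  apply: (@continuous_comp _ _ _ snd (fun M : tensor R n p l => M i j)).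
    exact: cvg_snd.
  exact: coord_continuous.
Qed.
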